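(* Let $\mathcal{G}_1$ be an $r_1$-regular graph of order $n_1$ with signless Laplacian eigenvalues $\nu_{11},\ldots,\nu_{1n_1}$, and let $\mathcal{G}_2$ be an arbitrary graph of order $n_2$ with signless Laplacian eigenvalues $\nu_{21},\ldots,\nu_{2n_2}$. Then the signless Laplacian characteristic polynomial of $\mathcal{G}_1\boxtimes\mathcal{G}_2$ is $$f(\mathcal{Q}_{\mathcal{G}_1\boxtimes\mathcal{G}_2},x)=\prod_{i=1}^{n_2}\big(x-(r_1+1)-\nu_{2i}\big)^{n_1}\cdot\prod_{i=1}^{n_1}\Big[x-n_2(r_1+1)-\nu_{1i}-\chi_{\mathcal{Q}_{\mathcal{G}_2}}\big(x-(r_1+1)\big)(1-r_1+\nu_{1i})^2\Big].$$
   Context: All graphs are finite, simple and undirected. For graphs $\mathcal{G}_1$ (vertices $u_1,\ldots,u_{n_1}$) and $\mathcal{G}_2$, the closed neighborhood corona $\mathcal{G}_1\boxtimes\mathcal{G}_2$ is obtained from $\mathcal{G}_1$ and $n_1$ disjoint copies of $\mathcal{G}_2$ by joining every vertex of the $i$-th copy to $u_i$ and to every neighbor of $u_i$ in $\mathcal{G}_1$, for each $i$. The signless Laplacian matrix is $\mathcal{Q}_{\mathcal{G}}=\mathcal{D}_{\mathcal{G}}+\mathcal{A}_{\mathcal{G}}$ (degree matrix plus adjacency matrix). For a square matrix $M$ of order $n$, $\chi_M(x)=\mathbf{1}_n^T(xI_n-M)^{-1}\mathbf{1}_n$ with $\mathbf{1}_n$ the all-ones vector, and $f(M,x)=\det(xI-M)$.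 *)

(* Defs.v *)
From HB Require Import structures.
From mathcomp Require Import all_boot all_order all_algebra.

Set Implicit Arguments.
Unset Strict Implicit.
Unset Printing Implicit Defensive.

Import GRing.Theory.
Local Open Scope ring_scope.

Record sgraph := SGraph {
  vertex : finType;
  edge : rel vertex;
  edge_sym : symmetric edge;
  edge_irr : irreflexive edge
}.

Definition degree (G : sgraph) (v : vertex G) : nat := #|[set w | edge v w]|.

Definition graph_order (G : sgraph) : nat := #|vertex G|.

Definition regular (G : sgraph) (r : nat) : Prop :=
  forall v : vertex G, degree v = r.

Section Corona.
Variables G1 G2 : sgraph.

(* [inl u] is the vertex u of G1; [inr (u, a)] is the vertex a of the copy of
   G2 attached to u. *)
Definition corona_vertex : finType := (vertex G1 + vertex G1 * vertex G2)%type.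

Definition corona_edge : rel corona_vertex := fun s t =>
  match s, t with
  | inl u, inl v => edge u v
  | inl u, inr (v, _) => (u == v) || edge v u
  | inr (u, _), inl v => (u == v) || edge u v
  | inr (u, a), inr (v, b) => (u == v) && edge a b
  end.

Lemma corona_edge_sym : symmetric corona_edge.
Proof.
move=> [u|[u a]] [v|[v b]] /=; last by rewrite eq_sym edge_sym.
- exact: edge_sym.
- by rewrite eq_sym.
- by rewrite eq_sym.
Qed.

Lemma corona_edge_irr : irreflexive corona_edge.
Proof. by move=> [u|[u a]] /=; rewrite edge_irr ?andbF. Qed.

Definition closed_nbhd_corona : sgraph :=
  SGraph corona_edge_sym corona_edge_irr.

End Corona.

(* Rows and columns are indexed through the enumeration of the vertex type. *)
Definition adjacency_mx (F : nzRingType) (G : sgraph) : 'M[F]_(graph_order G) :=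
  \matrix_(i, j) (@edge G (enum_val i) (enum_val j))%:R.

Definition degree_mx (F : nzRingType) (G : sgraph) : 'M[F]_(graph_order G) :=
  diag_mx (\row_i (@degree G (enum_val i))%:R).

Definition signless_laplacian (F : nzRingType) (G : sgraph) :
  'M[F]_(graph_order G) := degree_mx F G + adjacency_mx F G.

Definition charpoly_at (F : fieldType) (n : nat) (M : 'M[F]_n) (x : F) : F :=
  \det (x%:M - M).

(* Meaningful only when x%:M - M is invertible: [invmx] is the identity on
   singular matrices. *)
Definition coronal (F : fieldType) (n : nat) (M : 'M[F]_n) (x : F) : F :=
  ((const_mx 1 : 'rV[F]_n) *m invmx (x%:M - M) *m (const_mx 1 : 'cV[F]_n))
    ord0 ord0.

(* nu lists the eigenvalues of M with their algebraic multiplicities. *)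
Definition eigenvalue_list (F : fieldType) (n m : nat) (M : 'M[F]_n)
    (nu : 'I_m -> F) : Prop :=
  char_poly M = \prod_(i < m) ('X - (nu i)%:P).

(* The constant c and the indeterminate x in the field of rational functions. *)
Definition ratC (R : idomainType) (c : R) : {fraction {poly R}} :=
  FracField.tofrac c%:P.

Definition ratX (R : idomainType) : {fraction {poly R}} :=
  FracField.tofrac 'X.

(* Main.v *)
(** Order the vertices of the corona as those of [G1] followed by the copies of
    [G2].  As [G1] is [r]-regular, the matrix [x - Q] is the block matrix
    [[ ((x - n2 (r + 1)) - Q1) *t 1 , - K *t 1^T ], [ - K *t 1 , I *t M ]]
    with [K = I + A1] and [M = (x - (r + 1)) - Q2].  Its determinant is
    [det M ^ n1] times that of the Schur complement
    [(x - n2 (r + 1)) - Q1 - (1^T M^-1 1) K^2].  By regularity again,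
    [K = (1 - r) + Q1], so the complement is a polynomial in [Q1].  Its
    eigenvalues are the values of this polynomial at those of [Q1], as one sees
    on a triangular form of [Q1], which exists because the characteristic
    polynomial of [Q1] splits. *)

Require Import Defs.
From HB Require Import structures.
From mathcomp Require Import all_boot all_order all_algebra.
From mathcomp Require Import perm mxtens.

Set Implicit Arguments.
Unset Strict Implicit.
Unset Printing Implicit Defensive.

Import GRing.Theory.
Local Open Scope ring_scope.

Lemma horner_char_poly (R : comNzRingType) n (A : 'M[R]_n) x :
  (char_poly A).[x] = \det (x%:M - A).
Proof.
rewrite /char_poly -horner_evalE -det_map_mx; congr (\det _).
by apply/matrixP => i j; rewrite !mxE /= horner_evalE !hornerE hornerMn hornerX.
Qed.

Lemma char_poly_lblock (R : comNzRingType) m n (A : 'M[R]_m) C (B : 'M[R]_n) :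
  char_poly (block_mx A 0 C B) = char_poly A * char_poly B.
Proof.
rewrite /char_poly /char_poly_mx map_block_mx map_mx0 scalar_mx_block.
by rewrite opp_block_mx oppr0 add_block_mx addr0 det_lblock.
Qed.

Lemma mulmx_is_trig (R : pzSemiRingType) n (A B : 'M[R]_n) :
  is_trig_mx A -> is_trig_mx B -> is_trig_mx (A *m B).
Proof.
move=> /is_trig_mxP trigA /is_trig_mxP trigB; apply/is_trig_mxP => i j ltij.
rewrite mxE big1 // => k _; have [ltik|leki] := ltnP i k.
  by rewrite trigA ?mul0r.
by rewrite trigB ?mulr0 // (leq_ltn_trans leki).
Qed.

Lemma mulmx_trig_diag (R : pzSemiRingType) n (A B : 'M[R]_n) i :
  is_trig_mx A -> is_trig_mx B -> (A *m B) i i = A i i * B i i.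
Proof.
move=> /is_trig_mxP trigA /is_trig_mxP trigB.
rewrite mxE (bigD1 i) //= big1 ?addr0 // => k.
rewrite neq_ltn => /orP[ltki|ltik].
  by rewrite trigB ?mulr0.
by rewrite trigA ?mul0r.
Qed.

Lemma horner_mx_trig (R : comNzRingType) n (A : 'M[R]_n.+1) p :
  is_trig_mx A ->
  is_trig_mx (horner_mx A p) /\ forall i, horner_mx A p i i = p.[A i i].
Proof.
move=> trigA; elim/poly_ind: p => [|p c [trigp diagp]].
  by rewrite rmorph0; split=> [|i]; rewrite ?mx0_is_trig // mxE horner0.
rewrite rmorphD rmorphM /= horner_mx_X horner_mx_C; split=> [|i].
  have /is_trig_mxP trigpA := mulmx_is_trig trigp trigA.
  apply/is_trig_mxP => i j ltij.
  by rewrite mxE trigpA // add0r mxE -val_eqE ltn_eqF.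
by rewrite mxE mulmx_trig_diag // diagp mxE eqxx !hornerE.
Qed.

Section Trigonalization.
Variable F : fieldType.

Lemma char_poly_conjmx n (P A : 'M[F]_n) :
  P \in unitmx -> char_poly (conjmx P A) = char_poly A.
Proof.
move=> Pu; have mapPK : map_mx polyC P *m map_mx polyC (invmx P) = 1%:M.
  by rewrite -map_mxM mulmxV // map_mx1.
have charPA : char_poly_mx (conjmx P A) =
    map_mx polyC P *m char_poly_mx A *m map_mx polyC (invmx P).
  rewrite conjumx // /char_poly_mx mulmxBr mulmxBl !map_mxM; congr (_ - _).
  by rewrite scalar_mxC -mulmxA mapPK mulmx1.
by rewrite /char_poly charPA !det_mulmx mulrAC -det_mulmx mapPK det1 mul1r.
Qed.

Lemma eigenvalue_conjmx_lblock n (A : 'M[F]_(1 + n)) a :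
  eigenvalue A a ->
  exists2 P, P \in unitmx & exists C B, conjmx P A = block_mx a%:M 0 C B.
Proof.
case/eigenvalueP=> v vA v_neq0; pose P := row_ebase v.
have Pu : P \in unitmx by exact: row_ebase_unit.
exists P; first exact: Pu.
exists (dlsubmx (conjmx P A)), (drsubmx (conjmx P A)).
pose e : 'rV[F]_(1 + n) := row_mx 1%:M 0.
have defv : col_ebase v *m (e *m P) = v.
  rewrite mulmxA -[RHS]mulmx_ebase rank_rV v_neq0; congr (_ *m _ *m _).
  by rewrite (pid_mx_row _ n 1).
have ePA : e *m P *m A = a *: (e *m P).
  apply: (can_inj (mulKmx (col_ebase_unit v))).
  by rewrite mulmxA defv vA -scalemxAr defv.
have usub_conjA : usubmx (conjmx P A) = a *: e.
  rewrite -[RHS](mulmxK Pu) -scalemxAl -ePA conjumx // -!mulmxA.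
  by rewrite -{2}(vsubmxK (P *m _)) mul_row_col mul0mx addr0 mul1mx.
rewrite -[LHS]submxK /ulsubmx /ursubmx usub_conjA /e scale_row_mx.
by rewrite row_mxKl row_mxKr scaler0 scalemx1.
Qed.

Lemma trigonalizable_lblock n (a : 'M[F]_1) C (B : 'M[F]_n) :
  trigonalizable B -> trigonalizable (block_mx a 0 C B).
Proof.
case=> Q Qu trigQB; pose P : 'M_(1 + n) := block_mx 1%:M 0 0 Q.
have Pu : P \in unitmx by rewrite unitmxE det_lblock det1 mul1r -unitmxE.
exists P => //; rewrite /similar_to.
have /eqP-> : similar P (block_mx a 0 C B) (block_mx a 0 (Q *m C) (conjmx Q B)).
  apply/similarP => //; rewrite !mulmx_block conjumx // mulmxKV //.
  by rewrite !(mul1mx, mulmx1, mul0mx, mulmx0, addr0, add0r).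
by rewrite is_trig_block_mx // eqxx mx11_is_trig.
Qed.

Lemma split_char_poly_trigonalizable n (A : 'M[F]_n) (s : seq F) :
  char_poly A = \prod_(a <- s) ('X - a%:P) -> trigonalizable A.
Proof.
elim: n A s => [|n IHn] A s charA.
  by exists 1%:M; [exact: unitmx1 | apply/is_trig_mxP => -[]].
case: s charA => [|a s] charA.
  by have := size_char_poly A; rewrite charA big_nil size_poly1.
have eigAa : eigenvalue A a.
  by rewrite eigenvalue_root_char charA root_prod_XsubC mem_head.
have [P Pu [C [B PA]]] := eigenvalue_conjmx_lblock eigAa.
have charB : char_poly B = \prod_(b <- s) ('X - b%:P).
  apply: (mulfI (monic_neq0 (monicXsubC a))).
  transitivity (char_poly A); last by rewrite charA big_cons.
  rewrite -(char_poly_conjmx _ Pu) PA char_poly_lblock.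
  by rewrite (char_poly_trig (mx11_is_trig _)) big_ord1 mxE.
have [Q Qu trigQ] := trigonalizable_lblock a%:M C (IHn _ _ charB).
by exists (Q *m P); rewrite ?unitmx_mul ?Qu // /similar_to conjuMumx // PA.
Qed.

Lemma eigenvalue_list_horner_mx n m (A : 'M[F]_n.+1) (nu : 'I_m -> F) p :
  eigenvalue_list A nu ->
  eigenvalue_list (horner_mx A p) (fun i => p.[nu i]).
Proof.
move=> eigA.
have [P Pu trigPA] : trigonalizable A.
  by apply: (@split_char_poly_trigonalizable _ _ (codom nu)); rewrite big_image.
have perm_nu : perm_eq (codom (fun i => conjmx P A i i)) (codom nu).
  apply: prod_XsubC_eq; rewrite !big_image /= -eigA -(char_poly_conjmx _ Pu).
  by rewrite char_poly_trig.
have [trigp diagp] := horner_mx_trig p trigPA.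
rewrite /eigenvalue_list -(char_poly_conjmx _ Pu).
rewrite -horner_mx_conj ?row_free_unit ?stablemx_unit // char_poly_trig //.
transitivity (\prod_(a <- codom (fun i => conjmx P A i i)) ('X - p.[a]%:P)).
  by rewrite big_image; apply: eq_bigr => i _; rewrite diagp.
by rewrite (perm_big _ perm_nu) big_image.
Qed.

Lemma eigenvalue_list_quadratic n (A : 'M[F]_n) (nu : 'I_n -> F) h k :
  eigenvalue_list A nu ->
  eigenvalue_list (A + h *: (k%:M + A) ^+ 2)
    (fun i => nu i + h * (k + nu i) ^+ 2).
Proof.
case: n A nu => [|n] A nu.
  by rewrite /eigenvalue_list !big_ord0 ![char_poly _]det_mx00.
move/(eigenvalue_list_horner_mx ('X + h *: (k%:P + 'X) ^+ 2)).
rewrite /eigenvalue_list rmorphD /= horner_mxZ rmorphXn rmorphD /=.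
rewrite horner_mx_C horner_mx_X => ->.
by apply: eq_bigr => i _; rewrite !hornerE.
Qed.

Lemma charpoly_at_eigenvalues n m (A : 'M[F]_n) (nu : 'I_m -> F) x :
  eigenvalue_list A nu -> charpoly_at A x = \prod_i (x - nu i).
Proof.
move=> eigA; rewrite /charpoly_at -horner_char_poly eigA horner_prod.
by apply: eq_bigr => i _; rewrite hornerXsubC.
Qed.

Lemma map_eigenvalue_list (K : fieldType) (f : {rmorphism F -> K}) n m
    (A : 'M[F]_n) (nu : 'I_m -> F) :
  eigenvalue_list A nu -> eigenvalue_list (map_mx f A) (f \o nu).
Proof.
rewrite /eigenvalue_list -map_char_poly => ->; exact: map_prod_XsubC.
Qed.

End Trigonalization.

Section Determinants.
Variable R : comNzRingType.

Lemma det_mxsub_bij m n (h : 'I_m -> 'I_n) (A : 'M[R]_n) :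
  bijective h -> \det (mxsub h h A) = \det A.
Proof.
move=> bij_h; have := bij_eq_card bij_h; rewrite !card_ord => eq_mn; subst m.
pose s := perm (bij_inj bij_h).
have -> : mxsub h h A = row_perm s (col_perm s A).
  by apply/matrixP => i j; rewrite !mxE !permE.
rewrite row_permE col_permE !det_mulmx !det_perm odd_permV mulrCA.
by rewrite -signr_addb addbb mulr1.
Qed.

Lemma det_castmx m n (eq_mn : m = n) (A : 'M[R]_m) :
  \det (castmx (eq_mn, eq_mn) A) = \det A.
Proof. by case: n / eq_mn. Qed.

Lemma det_tens1mx n m (A : 'M[R]_m) :
  \det ((1%:M : 'M_n) *t A) = \det A ^+ n.
Proof.
elim: n => [|n IHn]; first exact: det_mx00.
have -> : (1%:M : 'M[R]_n.+1) = block_mx (1%:M : 'M_1) 0 0 1%:M.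
  exact: (scalar_mx_block 1 n).
rewrite tens_block_mx det_castmx tens0mx det_lblock IHn.
by rewrite tens_scalar_mx det_castmx scale1r exprS.
Qed.

Lemma det_tensmx1 n (A : 'M[R]_n) :
  \det (A *t (1%:M : 'M_1)) = \det A.
Proof. by rewrite tens_mx_scalar det_castmx scale1r. Qed.

(* The lower left block [C] is given as [D *m X], with [X] in the role of
   [D^-1 C], so that [D] need not be invertible. *)
Lemma det_block_schur m n (A : 'M[R]_m) B (D : 'M[R]_n) X :
  \det (block_mx A B (D *m X) D) = \det D * \det (A - B *m X).
Proof.
have -> : block_mx A B (D *m X) D =
    block_mx (A - B *m X) B 0 D *m block_mx 1%:M 0 X 1%:M.
  by rewrite mulmx_block !(mulmx1, mulmx0, mul0mx, add0r) subrK.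
by rewrite det_mulmx det_ublock det_lblock !det1 !mulr1 mulrC.
Qed.

End Determinants.

Lemma det_block_tensmx (R : comUnitRingType) n m (A K L : 'M[R]_n)
    (b : 'rV_m) (c : 'cV_m) (M : 'M[R]_m) : M \in unitmx ->
  \det (block_mx (A *t (1%:M : 'M_1)) (K *t b) (L *t c) (1%:M *t M))
  = \det M ^+ n * \det (A - (b *m invmx M *m c) 0 0 *: (K *m L)).
Proof.
move=> Mu; set s := (b *m _ *m c) 0 0.
have -> : L *t c = (1%:M *t M) *m (L *t (invmx M *m c)).
  by rewrite tensmx_mul mul1mx mulKVmx.
rewrite det_block_schur det_tens1mx tensmx_mul mulmxA; congr (_ * _).
rewrite [b *m _ *m c]mx11_scalar -/s -[RHS]det_tensmx1; congr (\det _).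
by apply/matrixP => i j; rewrite !mxE !ord1 mulr1n mulrBl !mulr1 mulrC.
Qed.

Lemma degree_sum (G : sgraph) (v : vertex G) :
  degree v = (\sum_w edge v w)%N.
Proof. by rewrite /degree cardsE -sum1_card big_mkcond. Qed.

Lemma sum_closed_nbhd (G : sgraph) (u : vertex G) :
  (\sum_v ((u == v) || edge u v))%N = (degree u).+1.
Proof.
rewrite degree_sum (bigD1 u) //= eqxx (bigD1 u (P := xpredT)) //= edge_irr.
by congr _.+1; apply: eq_bigr => v; rewrite eq_sym => /negPf ->.
Qed.

Section CoronaDegrees.
Variables G1 G2 : sgraph.
Implicit Types (u : vertex G1) (a : vertex G2).

Lemma sum_corona_vertex (f : corona_vertex G1 G2 -> nat) :
  (\sum_w f w = \sum_u f (inl u) + \sum_u \sum_a f (inr (u, a)))%N.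
Proof.
by rewrite big_sumType /=; congr addn; rewrite pair_big; apply: eq_bigr => -[].
Qed.

Lemma degree_corona_base u :
  @degree (closed_nbhd_corona G1 G2) (inl u)
    = (degree u + graph_order G2 * (degree u).+1)%N.
Proof.
rewrite degree_sum sum_corona_vertex /= -degree_sum; congr addn.
rewrite -sum_closed_nbhd big_distrr; apply: eq_bigr => v _.
by rewrite sum_nat_const edge_sym.
Qed.

Lemma degree_corona_copy u a :
  @degree (closed_nbhd_corona G1 G2) (inr (u, a))
    = ((degree u).+1 + degree a)%N.
Proof.
rewrite degree_sum sum_corona_vertex /= sum_closed_nbhd; congr addn.
rewrite (bigD1 u) //= [X in (_ + X)%N]big1 ?addn0.
  by rewrite degree_sum; apply: eq_bigr => b _; rewrite eqxx.
by move=> v /negPf uv; rewrite big1 // => b _; rewrite eq_sym uv.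
Qed.

End CoronaDegrees.

Section GraphMatrices.
Variables (R : nzRingType) (G : sgraph).

Definition closed_adjacency_mx : 'M[R]_(graph_order G) :=
  1%:M + adjacency_mx R G.

Lemma closed_adjacency_mxE u v :
  closed_adjacency_mx (enum_rank u) (enum_rank v) = ((u == v) || edge u v)%:R.
Proof.
rewrite !mxE !enum_rankK (inj_eq enum_rank_inj).
by have [->|] := eqVneq u v; rewrite ?edge_irr ?addr0 ?add0r.
Qed.

Lemma closed_adjacency_mx_regular r : regular G r ->
  closed_adjacency_mx = (1 - r%:R)%:M + signless_laplacian R G.
Proof.
move=> regG; have -> : signless_laplacian R G = r%:R%:M + adjacency_mx R G.
  by congr (_ + _); apply/matrixP => i j; rewrite !mxE regG.
by rewrite addrA -raddfD subrK.
Qed.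

Lemma scalar_sub_signless_laplacianE x u v :
  (x%:M - signless_laplacian R G) (enum_rank u) (enum_rank v)
  = (x - (degree u)%:R) *+ (u == v) - (edge u v)%:R.
Proof.
rewrite !mxE !enum_rankK (inj_eq enum_rank_inj).
by rewrite opprD addrA mulrnBl.
Qed.

Lemma map_signless_laplacian (S : nzRingType) (f : {rmorphism R -> S}) :
  map_mx f (signless_laplacian R G) = signless_laplacian S G.
Proof.
by apply/matrixP => i j; rewrite !mxE rmorphD !rmorphMn !rmorph1.
Qed.

End GraphMatrices.

Section CoronaCharpoly.
Variables G1 G2 : sgraph.
Local Notation n1 := (graph_order G1).
Local Notation n2 := (graph_order G2).
Local Notation corona := (closed_nbhd_corona G1 G2).

(* The factor 1 makes the vertices of [G1] index Kronecker products with 1 by 1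
   matrices. *)
Definition corona_rank (w : vertex corona) : 'I_(n1 * 1 + n1 * n2) :=
  match w with
  | inl u => lshift _ (mxtens_index (enum_rank u, ord0))
  | inr (u, a) => rshift _ (mxtens_index (enum_rank u, enum_rank a))
  end.

Lemma corona_rank_bij : bijective corona_rank.
Proof.
apply: inj_card_bij.
  move=> [u|[u a]] [v|[v b]] /eqP; rewrite eq_shift //;
    move=> /eqP/(can_inj (@mxtens_indexK _ _)) [].
    by move/enum_rank_inj ->.
  by move=> /enum_rank_inj -> /enum_rank_inj ->.
by rewrite card_ord card_sum card_prod muln1.
Qed.

Variable r : nat.
Hypothesis regG1 : regular G1 r.

Lemma scalar_sub_signless_laplacian_corona (R : nzRingType) (x : R) :
  x%:M - signless_laplacian R corona =
  mxsub (corona_rank \o enum_val) (corona_rank \o enum_val)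
    (block_mx
       (((x - (n2 * (r + 1))%:R)%:M - signless_laplacian R G1) *t (1%:M : 'M_1))
       (- closed_adjacency_mx R G1 *t const_mx 1)
       (- closed_adjacency_mx R G1 *t const_mx 1)
       (1%:M *t ((x - (r + 1)%:R)%:M - signless_laplacian R G2))).
Proof.
apply/matrixP => i j; rewrite -(enum_valK i) -(enum_valK j).
rewrite scalar_sub_signless_laplacianE [RHS]mxE /= !enum_rankK.
case: (enum_val i) (enum_val j) => [u|[u a]] [v|[v b]] /=;
  rewrite ?block_mxEul ?block_mxEur ?block_mxEdl ?block_mxEdr tensmxE.
- rewrite scalar_sub_signless_laplacianE degree_corona_base regG1 addn1.
  by rewrite mxE mulr1 (inj_eq inl_inj) natrD opprD addrA addrAC.
- by rewrite sub0r [const_mx _ _ _]mxE mulr1 mxE closed_adjacency_mxE edge_sym.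
- by rewrite sub0r [const_mx _ _ _]mxE mulr1 mxE closed_adjacency_mxE.
- rewrite scalar_sub_signless_laplacianE degree_corona_copy regG1 addn1.
  rewrite mxE (inj_eq enum_rank_inj) (inj_eq inr_inj) xpair_eqE.
  rewrite natrD opprD addrA.
  by case: eqVneq => _ /=; rewrite ?mul1r // mul0r subr0.
Qed.

Variable F : fieldType.
Local Notation Q1 := (signless_laplacian F G1).
Local Notation Q2 := (signless_laplacian F G2).

Lemma charpoly_corona_regular (x : F) :
  (x - (r + 1)%:R)%:M - Q2 \in unitmx ->
  charpoly_at (signless_laplacian F corona) x
  = charpoly_at Q2 (x - (r + 1)%:R) ^+ n1
    * charpoly_at
        (Q1 + coronal Q2 (x - (r + 1)%:R) *: ((1 - r%:R)%:M + Q1) ^+ 2)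
        (x - (n2 * (r + 1))%:R).
Proof.
move=> Q2x_unit; rewrite /charpoly_at scalar_sub_signless_laplacian_corona.
have rank_bij : bijective (corona_rank \o @enum_val (vertex corona) predT).
  exact: bij_comp corona_rank_bij (enum_val_bij _).
rewrite (det_mxsub_bij _ rank_bij) det_block_tensmx // mulNmx mulmxN opprK.
by rewrite (closed_adjacency_mx_regular _ regG1) -addrA -opprD.
Qed.

Lemma charpoly_corona_eigenvalues m (nu1 : 'I_n1 -> F) (nu2 : 'I_m -> F) x :
  eigenvalue_list Q1 nu1 -> eigenvalue_list Q2 nu2 ->
  (x - (r + 1)%:R)%:M - Q2 \in unitmx ->
  charpoly_at (signless_laplacian F corona) x
  = (\prod_i (x - (r + 1)%:R - nu2 i) ^+ n1)
    * (\prod_i (x - (n2 * (r + 1))%:R - nu1 i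
                - coronal Q2 (x - (r + 1)%:R) * (1 - r%:R + nu1 i) ^+ 2)).
Proof.
move=> eig1 eig2 Q2x_unit; rewrite charpoly_corona_regular //.
rewrite (charpoly_at_eigenvalues _ eig2) prodrXl; congr (_ * _).
rewrite (charpoly_at_eigenvalues _ (eigenvalue_list_quadratic _ _ eig1)).
by apply: eq_bigr => i _; rewrite opprD addrA.
Qed.

End CoronaCharpoly.

Section RationalFunctions.
Variable R : idomainType.

HB.instance Definition _ := GRing.RMorphism.copy (@ratC R)
  (@FracField.tofrac {poly R} \o polyC).

Lemma ratX_sub_unitmx n (A : 'M[R]_n) (c : R) :
  (ratX R - ratC c)%:M - map_mx (@ratC R) A \in unitmx.
Proof.
have -> : (ratX R - ratC c)%:M - map_mx (@ratC R) A
    = map_mx (@FracField.tofrac _) (char_poly_mx (c%:M + A)).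
  rewrite map_mxB map_scalar_mx -map_mx_comp map_mxD map_scalar_mx /=.
  by rewrite raddfB opprD addrA.
rewrite unitmxE det_map_mx unitfE tofrac_eq0.
exact: monic_neq0 (char_poly_monic _).
Qed.

End RationalFunctions.

Theorem theorem3 (R : rcfType) (G1 G2 : sgraph) (n1 n2 r1 : nat)
    (nu1 : 'I_n1 -> R) (nu2 : 'I_n2 -> R)
    (order1 : graph_order G1 = n1) (order2 : graph_order G2 = n2)
    (reg1 : regular G1 r1)
    (eig1 : eigenvalue_list (signless_laplacian R G1) nu1)
    (eig2 : eigenvalue_list (signless_laplacian R G2) nu2) :
  (* as an identity of rational functions in the indeterminate x *)
  charpoly_at (signless_laplacian {fraction {poly R}}
                 (closed_nbhd_corona G1 G2)) (ratX R)
    = (\prod_(i < n2) (ratX R - (r1 + 1)%:R - ratC (nu2 i)) ^+ n1)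
      * (\prod_(i < n1)
           (ratX R - (n2 * (r1 + 1))%:R - ratC (nu1 i)
            - coronal (signless_laplacian {fraction {poly R}} G2)
                (ratX R - (r1 + 1)%:R)
              * (1 - r1%:R + ratC (nu1 i)) ^+ 2))
  /\
  (* as an equality of values at every x where the coronal is defined *)
  (forall x : R,
     (x - (r1 + 1)%:R)%:M - signless_laplacian R G2 \in unitmx ->
     charpoly_at (signless_laplacian R (closed_nbhd_corona G1 G2)) x
       = (\prod_(i < n2) (x - (r1 + 1)%:R - nu2 i) ^+ n1)
         * (\prod_(i < n1)
              (x - (n2 * (r1 + 1))%:R - nu1 i
               - coronal (signless_laplacian R G2) (x - (r1 + 1)%:R)
                 * (1 - r1%:R + nu1 i) ^+ 2))).
Proof.
subst n1 n2; split=> [|x]; last exact: charpoly_corona_eigenvalues.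
have eig1_rat := map_eigenvalue_list (@ratC R) eig1.
have eig2_rat := map_eigenvalue_list (@ratC R) eig2.
rewrite !map_signless_laplacian in eig1_rat eig2_rat.
apply: (charpoly_corona_eigenvalues reg1 eig1_rat eig2_rat).
have := ratX_sub_unitmx (signless_laplacian R G2) (r1 + 1)%:R.
by rewrite map_signless_laplacian rmorph_nat.
Qed.
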